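(* Let ${\bf E}$ be an $n$-dimensional nilpotent evolution algebra over $\mathbb K$ with maximal index of nilpotency, with fixed natural basis $\{{\bf e}_1,\dots,{\bf e}_n\}$ in normal form, and let $R$ be a Rota-Baxter operator of weight $1$ on ${\bf E}$ with $R({\bf e}_i)=\sum_{k=1}^n r_{i,k}{\bf e}_k$. If $R\in\mathcal{RB}_1^{\blacktriangle}({\bf E})$, i.e. if $r_{i,j}\neq0$ for some $i<j<n$, then either $r_{1,1}=\dots=r_{n,n}=-1$ or $r_{1,1}=\dots=r_{n,n}=0$.
   Context: $\mathbb K$ is $\mathbb R$ or $\mathbb C$. An evolution algebra over $\mathbb K$ is a vector space ${\bf E}$ with a bilinear multiplication and a basis $\{{\bf e}_i\}$ (a natural basis) such that ${\bf e}_i{\bf e}_j={\bf 0}$ for $i\ne j$ (and ${\bf e}_i^2$ is a linear combination of basis vectors). ''Nilpotent with maximal index of nilpotency'' means ${\bf E}$ is nilpotent with $\dim({\bf E}\cdot{\bf E})=n-1$; throughout, for such ${\bf E}$ a natural basis in normal form is fixed, meaning ${\bf e}_i^2=\sum_{j=i+1}^{n}a_{i,j}{\bf e}_j$ for $i<n$ and ${\bf e}_n^2={\bf 0}$, where $a_{i,j}\in\mathbb K$, $a_{i,i+1}=1$ for all $i<n$, and $a_{i,n}=0$ for all $i\le n-2$. A linear map $R:{\bf E}\to{\bf E}$ is a Rota-Baxter operator of weight $1$ if $R({\bf x})R({\bf y})=R(R({\bf x}){\bf y}+{\bf x}R({\bf y})+{\bf x}{\bf y})$ for all ${\bf x},{\bf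 y}\in{\bf E}$; such operators satisfy $r_{i,k}=0$ for $k<i$. $\mathcal{RB}_1^{\blacktriangle}({\bf E})$ denotes the set of Rota-Baxter operators of weight $1$ on ${\bf E}$ for which it is not the case that $r_{i,j}=0$ for all $i<j<n$. *)

(* Defs.v *)
From mathcomp Require Import all_boot all_order all_algebra.
From mathcomp Require Import complex reals.

Set Implicit Arguments.
Unset Strict Implicit.
Unset Printing Implicit Defensive.

Import GRing.Theory.
Local Open Scope ring_scope.

Variant ground := RealGround | ComplexGround.

Definition scalars (R : realType) (g : ground) : fieldType :=
  match g with RealGround => R | ComplexGround => R[i] end.

Section EvolutionAlgebra.

Variables (K : fieldType) (E : vectType K) (mul : {bilinear E -> E -> E}).

(* By bilinearity, products of basis vectors span the same subspace as all the
   products u v with u in U and v in V. *)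
Definition mulv (U V : {vspace E}) : {vspace E} :=
  <<[seq mul u v | u <- vbasis U, v <- vbasis V]>>%VS.

(* The multiplication is not associative in general, so E^m is the sum of all
   E^i E^(m-i), 0 < i < m; this determines P m for every m > 0. *)
Definition is_power_sequence (P : nat -> {vspace E}) : Prop :=
  P 1%N = fullv /\
  (forall m : nat, (1 < m)%N ->
     P m = (\sum_(1 <= i < m) mulv (P i) (P (m - i)%N))%VS).

Definition nilpotent_alg : Prop :=
  exists P : nat -> {vspace E},
    is_power_sequence P /\ exists m : nat, (0 < m)%N /\ P m = 0%VS.

(* Written without truncated subtraction. *)
Definition max_nilpotent_alg : Prop :=
  nilpotent_alg /\ (\dim (mulv fullv fullv)).+1 = \dim (@fullv K E).

Definition RB1 (R : 'End(E)) : Prop :=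
  forall x y : E,
    mul (R x) (R y) = R (mul (R x) y + mul x (R y) + mul x y).

Variables (n : nat) (e : n.-tuple E).

Definition natural_basis : Prop :=
  basis_of fullv e /\
  (forall i j : 'I_n, i != j -> mul (tnth e i) (tnth e j) = 0).

(* Indices are shifted: i : 'I_n stands for the 1-based index i + 1, so the last
   basis vector is the one with i.+1 = n, and the 1-based condition i <= n - 2
   reads i.+2 < n. *)
Definition normal_form : Prop :=
  exists a : 'M[K]_n,
    [/\ forall i : 'I_n, (i.+1 < n)%N ->
          mul (tnth e i) (tnth e i) = \sum_(j < n | (i < j)%N) a i j *: tnth e j,
        forall i : 'I_n, i.+1 = n -> mul (tnth e i) (tnth e i) = 0,
        forall i j : 'I_n, j = i.+1 :> nat -> a i j = 1
      & forall i j : 'I_n, (i.+2 < n)%N -> j.+1 = n -> a i j = 0].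

(* When e is a basis, R e_i = \sum_k (rb_coef R i k) e_k. *)
Definition rb_coef (R : 'End(E)) (i k : 'I_n) : K := coord e k (R (tnth e i)).

Definition RB1_triangle (R : 'End(E)) : Prop :=
  RB1 R /\
  ~ (forall i j : 'I_n, (i < j)%N -> (j.+1 < n)%N -> rb_coef R i j = 0).

End EvolutionAlgebra.

(* Main.v *)
Require Import Defs.
From mathcomp Require Import all_boot all_order all_algebra.
From mathcomp Require Import complex reals.
From mathcomp Require Import ring.

(** Indices are 0-based, [r i k] are the coefficients of [R], [d_i] is [r i i],
    and the [s]-th tail is the span of the basis vectors of index at least [s].
    In a natural basis [x y] is the sum of the [x_k y_k e_k^2], and in normal
    form [e_k^2] begins with [e_(k+1)], with coefficient 1.  So if
    [x_k y_k = 0] for all [k < s], then [x y] lies in the tail [s + 1]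
    ([mul_in_tail]) and its coefficient there is [x_s y_s] ([coord_mul_lead]).
    The theorem results from comparing leading coefficients in the Rota-Baxter
    identity.

    For the pair [(e_i, e_i)] this comparison shows that [R] is upper triangular
    ([RB1_upper_triangular]).  For [(e_i, e_j)] with [i <= j] it then gives, at
    index [j + 1] ([RB1_lead_relation]),
    - [d_j^2 = (2 d_j + 1) d_(j+1)] when [i = j];
    - [r i j * d_j = r i j * d_(j+1)] when [i < j].

    If [r i j] is nonzero for some [i < j] with [j] not the last index, the
    second relation gives [d_j = d_(j+1)], and the first one becomes
    [d_j (d_j + 1) = 0] ([offdiag_neq0_diag]).  Finally, each of the values 0
    and -1 spreads from one diagonal entry to both neighbours
    ([diag_succ_eq0], [diag_succ_eqN1]), hence to the whole diagonal. *)

Set Implicit Arguments.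
Unset Strict Implicit.
Unset Printing Implicit Defensive.

Import GRing.Theory.
Local Open Scope ring_scope.

Section RotaBaxter.

Variables (K : fieldType) (E : vectType K) (mul : {bilinear E -> E -> E}).
Variables (n : nat) (e : n.-tuple E).
Hypothesis He : natural_basis mul e.
Hypothesis Hnf : normal_form mul e.

Definition in_tail (s : nat) (x : E) : Prop :=
  forall k : 'I_n, (k < s)%N -> coord e k x = 0.

Lemma coord_natural_basis (k i : 'I_n) : coord e k (tnth e i) = (k == i)%:R.
Proof.
by rewrite (tnth_nth 0) coord_free 1?eq_sym //; case: He => /basis_free.
Qed.

Lemma basis_expansion (x : E) : x = \sum_k coord e k x *: tnth e k.
Proof.
have [base_e _] := He.
rewrite {1}(coord_basis base_e (memvf x)).
by apply: eq_bigr => k _; rewrite (tnth_nth 0).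
Qed.

Lemma coord_mul (x y : E) (m : 'I_n) :
  coord e m (mul x y) =
  \sum_k coord e k x * coord e k y * coord e m (mul (tnth e k) (tnth e k)).
Proof.
have [_ mul_e] := He.
rewrite {1}(basis_expansion x) linear_sumlz linear_sum; apply: eq_bigr => k _.
rewrite linearZl_LR linearZ_LR {1}(basis_expansion y) linear_sumr linear_sum /=.
rewrite -mulrA; congr (_ * _).
rewrite (bigD1 k) //= big1 ?addr0 => [|j neq_jk]; first by rewrite !linearZ.
by rewrite linearZ /= mul_e 1?eq_sym // scaler0 linear0.
Qed.

Lemma square_in_tail (k : 'I_n) : in_tail k.+1 (mul (tnth e k) (tnth e k)).
Proof.
have [a [sq_k sq_last _ _]] := Hnf => m lt_mk.
have [lt_kn|] := ltnP k.+1 n; last first.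
  by rewrite leq_eqVlt ltnNge ltn_ord orbF => /eqP/esym/sq_last ->; rewrite linear0.
rewrite sq_k // linear_sum big1 // => j lt_kj.
rewrite linearZ /= coord_natural_basis; case: eqP => [eq_mj|_]; last exact: mulr0.
by move: lt_kj; rewrite -eq_mj ltnNge -ltnS lt_mk.
Qed.

Lemma coord_square_succ (k m : 'I_n) :
  m = k.+1 :> nat -> coord e m (mul (tnth e k) (tnth e k)) = 1.
Proof.
have [a [sq_k _ a_succ _]] := Hnf => def_m.
rewrite sq_k -?def_m // linear_sum (bigD1 m) /= ?def_m //.
rewrite linearZ /= coord_natural_basis eqxx a_succ // mulr1.
rewrite big1 ?addr0 // => j /andP[_ neq_jm].
by rewrite linearZ /= coord_natural_basis eq_sym (negPf neq_jm) mulr0.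
Qed.

(** A square [e_k^2] lies in the tail [k + 1], so only the [e_k^2] with [k < s]
    could leave the tail [s + 1]. *)
Lemma mul_in_tail (s : nat) (x y : E) :
    (forall k : 'I_n, (k < s)%N -> coord e k x * coord e k y = 0) ->
  in_tail s.+1 (mul x y).
Proof.
move=> xy0 m le_ms; rewrite coord_mul big1 // => k _.
have [/xy0->|le_sk] := ltnP k s; first by rewrite mul0r.
by rewrite square_in_tail ?mulr0 // (leq_trans le_ms).
Qed.

(** The terms [k < j] vanish by hypothesis and the [e_k^2] with [k > j] start
    after [j + 1], which leaves [e_j^2]. *)
Lemma coord_mul_lead (j m : 'I_n) (x y : E) :
    m = j.+1 :> nat ->
    (forall k : 'I_n, (k < j)%N -> coord e k x * coord e k y = 0) ->
  coord e m (mul x y) = coord e j x * coord e j y.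
Proof.
move=> def_m xy0; rewrite coord_mul (bigD1 j) //= coord_square_succ // mulr1.
rewrite big1 ?addr0 // => k neq_kj.
have [/xy0->|le_jk] := ltnP k j; first by rewrite mul0r.
rewrite square_in_tail ?mulr0 // def_m ltnS ltn_neqAle le_jk andbT.
by rewrite eq_sym.
Qed.

Variable R : 'End(E).
Hypothesis HR : RB1 mul R.

Local Notation r := (rb_coef e R).

Lemma coord_image (x : E) (m : 'I_n) :
  coord e m (R x) = \sum_k coord e k x * r k m.
Proof.
rewrite {1}(basis_expansion x) !linear_sum; apply: eq_bigr => k _.
by rewrite !linearZ.
Qed.

(** [e_i y] is a multiple of [e_i^2] for every [y], whatever [R (e_i)] is;
    this is what starts the induction of [RB1_upper_triangular]. *)
Lemma rb_arg_in_tail (i : 'I_n) :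
  in_tail i.+1 (mul (R (tnth e i)) (tnth e i) + mul (tnth e i) (R (tnth e i))
                + mul (tnth e i) (tnth e i)).
Proof.
have e_i0 (k : 'I_n) : (k < i)%N -> coord e k (tnth e i) = 0.
  by move=> lt_ki; rewrite coord_natural_basis -val_eqE ltn_eqF.
move=> m lt_mi; rewrite !linearD /= !(mul_in_tail _ lt_mi) ?addr0 // => k /e_i0 ->;
  by rewrite ?mul0r ?mulr0.
Qed.

(** Downward induction on the row [i].  When the rows below are triangular, [R]
    preserves the tail [i + 1], so [R (e_i)^2], the image under [R] of an element
    of that tail, has no coordinate of index at most [i].  If [r i k] with [k < i]
    were the first nonzero entry of row [i], the coordinate [k + 1] of
    [R (e_i)^2] would be [(r i k)^2]. *)
Lemma RB1_upper_triangular (i k : 'I_n) : (k < i)%N -> r i k = 0.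
Proof.
(* [p] bounds the distance from row [i] to the end, [q] the column [k]. *)
have [p] := ubnP (n - i)%N; elim: p i k => // p IHp i k le_nip.
have [q] := ubnP k; elim: q k => // q IHq k le_kq lt_ki.
have lt_kn: (k.+1 < n)%N by apply: leq_ltn_trans (ltn_ord i).
have: coord e (Ordinal lt_kn) (mul (R (tnth e i)) (R (tnth e i))) = 0.
  rewrite HR coord_image big1 // => j _.
  have [le_ji|lt_ij] := leqP j i; first by rewrite rb_arg_in_tail ?mul0r.
  rewrite IHp ?mulr0 //; last exact: leq_ltn_trans lt_ij.
  by rewrite -ltnS; apply: leq_trans le_nip; rewrite ltnS ltn_sub2l // ltn_ord.
rewrite (@coord_mul_lead k) //; first by move/eqP; rewrite mulf_eq0 orbb => /eqP.
move=> j lt_jk; rewrite [coord e j _]IHq ?mul0r //; last exact: ltn_trans lt_ki.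
exact: leq_trans lt_jk _.
Qed.

(** Coordinate [j + 1] of the Rota-Baxter identity for [(e_i, e_j)].  Both sides
    of the identity start at index [j + 1]: [R (e_j)] and [e_j] have no earlier
    coordinate than [j], multiplication shifts by one, and [R] acts on leading
    coefficients of index [m] as multiplication by [r m m]. *)
Lemma RB1_lead_relation (i j m : 'I_n) :
    (i <= j)%N -> m = j.+1 :> nat ->
  r i j * r j j = (r i j + (i == j)%:R * (r j j + 1)) * r m m.
Proof.
move=> le_ij def_m.
have e_j0 (k : 'I_n) : (k < j)%N -> coord e k (tnth e j) = 0.
  by move=> lt_kj; rewrite coord_natural_basis -val_eqE ltn_eqF.
have R_j0 (k : 'I_n) : (k < j)%N -> coord e k (R (tnth e j)) = 0.
  exact: RB1_upper_triangular.
rewrite -[LHS](@coord_mul_lead j m (R (tnth e i)) (R (tnth e j))) //; last first.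
  by move=> k /R_j0 ->; rewrite mulr0.
rewrite HR coord_image (bigD1 m) //= big1 ?addr0 => [|k neq_km].
  congr (_ * _); rewrite !linearD /= !(coord_mul_lead def_m).
  - by rewrite !coord_natural_basis eqxx (eq_sym j) mulr1n -/(r i j) -/(r j j); ring.
  - by move=> k /e_j0 ->; rewrite mulr0.
  - by move=> k /R_j0 ->; rewrite mulr0.
  - by move=> k /e_j0 ->; rewrite mulr0.
have [lt_km|le_mk] := ltnP k m.
  rewrite def_m in lt_km.
  rewrite !linearD /= !(mul_in_tail _ lt_km) ?addr0 ?mul0r // => l /[dup] /e_j0 el /R_j0 Rl;
    by rewrite ?el ?Rl mulr0.
rewrite RB1_upper_triangular ?mulr0 // ltn_neqAle le_mk andbT eq_sym.
exact: neq_km.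
Qed.

Lemma diag_relation (j m : 'I_n) :
  m = j.+1 :> nat -> r j j ^+ 2 = (r j j *+ 2 + 1) * r m m.
Proof.
by move=> /(RB1_lead_relation (leqnn j)); rewrite eqxx mulr1n -expr2 => ->; ring.
Qed.

Lemma diag_succ_eq0 (j m : 'I_n) :
  m = j.+1 :> nat -> (r j j == 0) = (r m m == 0).
Proof.
move/diag_relation=> rel; apply/eqP/eqP => d0.
  by move: rel; rewrite d0 expr0n mul0rn add0r mul1r => <-.
by apply/eqP; rewrite -sqrf_eq0 rel d0 mulr0.
Qed.

(** If [R] has weight 1, so does [- R - id], whose diagonal entries are
    [- (d_j + 1)]; hence the mirror image
    [(d_j + 1)^2 = (2 d_j + 1) (d_(j+1) + 1)] of [diag_relation]. *)
Lemma diag_succ_eqN1 (j m : 'I_n) :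
  m = j.+1 :> nat -> (r j j == -1) = (r m m == -1).
Proof.
move/diag_relation=> rel; rewrite -!(addr_eq0 _ 1).
have {}rel : (r j j + 1) ^+ 2 = (r j j *+ 2 + 1) * (r m m + 1).
  by rewrite mulrDr -rel; ring.
apply/eqP/eqP => d0; last by apply/eqP; rewrite -sqrf_eq0 rel d0 mulr0.
have dj : r j j = -1 by apply/eqP; rewrite -addr_eq0 d0.
move: rel; rewrite dj => rel.
have -> : r m m + 1 = - ((-1 + 1) ^+ 2) by rewrite rel; ring.
by rewrite addNr expr0n oppr0.
Qed.

Lemma ord_succ_invariant (P : pred 'I_n) :
    (forall j m : 'I_n, m = j.+1 :> nat -> P j = P m) ->
  forall i j : 'I_n, P i = P j.
Proof.
move=> Psucc; suff P0 i (n_gt0 : (0 < n)%N) : P i = P (Ordinal n_gt0).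
  by move=> i j; have n_gt0 := leq_ltn_trans (leq0n _) (ltn_ord i); rewrite !(P0 _ n_gt0).
case: i => i; elim: i => [|i IHi] lt_in; first by congr P; apply: val_inj.
by rewrite -(IHi (ltnW lt_in)); apply/esym/Psucc.
Qed.

Lemma offdiag_neq0_diag (i j : 'I_n) :
    (i < j)%N -> (j.+1 < n)%N -> r i j != 0 -> r j j = -1 \/ r j j = 0.
Proof.
move=> lt_ij lt_jn nz_rij; pose m := Ordinal lt_jn.
have := RB1_lead_relation (ltnW lt_ij) (erefl : m = j.+1 :> nat).
rewrite -val_eqE (ltn_eqF lt_ij) mul0r addr0 => /(mulfI nz_rij) eq_d.
have := diag_relation (erefl : m = j.+1 :> nat); rewrite -eq_d => rel.
have /eqP : r j j * (r j j + 1) = 0.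
  have -> : r j j * (r j j + 1) = (r j j *+ 2 + 1) * r j j - r j j ^+ 2 by ring.
  by rewrite -rel subrr.
by rewrite mulf_eq0 addr_eq0 => /orP[/eqP|/eqP]; [right | left].
Qed.

End RotaBaxter.

Theorem mainTheorem6 (F : realType) (g : ground) (n : nat)
  (E : vectType (scalars F g)) (mul : {bilinear E -> E -> E})
  (e : n.-tuple E)
  (He : natural_basis mul e) (Hnil : max_nilpotent_alg mul)
  (Hnf : normal_form mul e)
  (R : 'End(E)) (HR : RB1_triangle mul e R) :
  (forall i : 'I_n, rb_coef e R i i = -1) \/
  (forall i : 'I_n, rb_coef e R i i = 0).
Proof.
have [RB not_offdiag0] := HR.
have [/existsP[i /existsP[j /and3P[lt_ij lt_jn nz_rij]]]|none] :=
  boolP [exists i : 'I_n, exists j : 'I_n,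
    [&& (i < j)%N, (j.+1 < n)%N & rb_coef e R i j != 0]]; last first.
  case: not_offdiag0 => i j lt_ij lt_jn; apply/eqP; apply: contraR none => nz_rij.
  by apply/existsP; exists i; apply/existsP; exists j; rewrite lt_ij lt_jn.
have [dj|dj] := offdiag_neq0_diag He Hnf RB lt_ij lt_jn nz_rij; [left | right] => k.
- have /= := ord_succ_invariant (P := fun l => rb_coef e R l l == -1)
    (diag_succ_eqN1 He Hnf RB) k j.
  by rewrite dj eqxx => /eqP.
- have /= := ord_succ_invariant (P := fun l => rb_coef e R l l == 0)
    (diag_succ_eq0 He Hnf RB) k j.
  by rewrite dj eqxx => /eqP.
Qed.
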